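(* For even positive integers $n = 2d$, let $L(n)$ denote the maximum length of $d$-dimensional subset partition graphs on $n=2d$ symbols satisfying the strong adjacency, endpoint-count, one-subset, and spindle properties. Let $\kappa = \frac18$. Then, for infinitely many $n$, \[\frac{L(n)}{n^2} \geq \kappa.\]
   Context: Subset partition graph: Let $S$ be a finite set of cardinality $n$ (the symbol set; its elements are called symbols), and let $\mathcal{A} \subseteq \binom{S}{d}$ be a set of $d$-element subsets of $S$. Let $G = (\mathcal{V},E)$ be a connected graph with vertex set $\mathcal{V} = \{\mathcal{V}_0,\ldots,\mathcal{V}_t\}$, where $\mathcal{V}$ is a partition of $\mathcal{A}$, i.e. (1) $\mathcal{A} = \mathcal{V}_0 \cup \cdots \cup \mathcal{V}_t$, (2) $\mathcal{V}_i \cap \mathcal{V}_j = \emptyset$ if $i \neq j$, and (3) $\mathcal{V}_i \neq \emptyset$ for all $i$. Then $G$ is called a $d$-dimensional subset partition graph of $\mathcal{A}$ on the symbol set $S$ (on $n = |S|$ symbols). Properties of a $d$-dimensional subset partition graph $G$ of $\mathcal{A}$ on $S$: Adjacency: if $A, A' \in \mathcal{A}$ and $|A \cap A'| = d-1$, then $A$ and $A'$ are in the same or adjacent vertices of $G$. Strong adjacency: adjacency holds and, if two vertices $\mathcal{V}_i$ and $\mathcal{V}_j$ are adjacent in $G$, then there are $d$-sets $A \in \mathcal{V}_i$ and $A' \in \mathcal{V}_j$ such that $|A \cap A'| = d-1$. Endpoint-count: if $F \in \binom{S}{d-1}$, then $|\{A \in \mathcal{A} : F \subset A\}| \leq 2$.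 One-subset: $|\mathcal{V}_i| = 1$ for each $i = 0, \ldots, t$. Spindle property: there are two distinguished subsets $A_1$ and $A_2$ (called the apices) belonging to $\mathcal{A}$ such that every symbol $s \in S$ belongs to exactly one of $A_1$ or $A_2$. Length: the length of a subset partition graph $G$ with the spindle property is the distance in the graph $G$ from one apex to the other, i.e. the graph distance between the vertex of $G$ containing $A_1$ and the vertex of $G$ containing $A_2$. *)

(* Defs.v *)
From mathcomp Require Import all_boot all_order all_algebra.

Set Implicit Arguments.
Unset Strict Implicit.
Unset Printing Implicit Defensive.

(* Vertices are blocks of a partition of A.  The edge relation is total on
   families of sets but is only allowed to hold between vertices. *)
Record subset_partition_graph (S : finType) (d : nat) (A : {set {set S}}) :=
  SubsetPartitionGraph {
    vertices : {set {set {set S}}};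
    adjacent : rel {set {set S}};
    spg_uniform : {in A, forall F : {set S}, #|F| = d};
    spg_partition : partition vertices A;
    spg_nonempty : vertices != set0;
    spg_support : forall X Y, adjacent X Y -> X \in vertices /\ Y \in vertices;
    spg_sym : symmetric adjacent;
    spg_irrefl : irreflexive adjacent;
    spg_connected : {in vertices &, forall X Y, connect adjacent X Y}
  }.

Section Properties.

Variables (S : finType) (d : nat) (A : {set {set S}}).
Variable G : subset_partition_graph d A.

Definition vertex_of (F : {set S}) : {set {set S}} := pblock (vertices G) F.

(* Sizes d - 1 are written with a successor, avoiding truncated subtraction. *)
Definition adjacency : Prop :=
  {in A &, forall F F' : {set S}, #|F :&: F'|.+1 = d ->
    vertex_of F = vertex_of F' \/ adjacent G (vertex_of F) (vertex_of F')}.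

Definition strong_adjacency : Prop :=
  adjacency /\
  forall X Y, adjacent G X Y ->
    exists F F' : {set S}, [/\ F \in X, F' \in Y & #|F :&: F'|.+1 = d].

Definition endpoint_count : Prop :=
  forall F : {set S}, #|F|.+1 = d -> #|[set B in A | F \subset B]| <= 2.

Definition one_subset : Prop := {in vertices G, forall X : {set {set S}}, #|X| = 1}.

Definition apices (A1 A2 : {set S}) : Prop :=
  [/\ A1 \in A, A2 \in A & forall s, (s \in A1) (+) (s \in A2)].

End Properties.

Definition graph_distance (T : eqType) (e : rel T) (x y : T) (k : nat) : Prop :=
  (exists p, [/\ path e x p, last x p = y & size p = k]) /\
  (forall p, path e x p -> last x p = y -> k <= size p).

Definition spindle_length (d l : nat) : Prop :=
  exists (S : finType) (A : {set {set S}}) (G : subset_partition_graph d A)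
         (A1 A2 : {set S}),
    [/\ #|S| = 2 * d,
        strong_adjacency G,
        endpoint_count d A,
        one_subset G &
        apices A A1 A2 /\
        graph_distance (adjacent G) (vertex_of G A1) (vertex_of G A2) l].

Definition max_spindle_length (d l : nat) : Prop :=
  spindle_length d l /\ forall l', spindle_length d l' -> l' <= l.

(* Main.v *)
(** The symbols are the pairs (t, b) with t in a d-element set and b a bit, so
    that a vertex x of the d-cube becomes the d-set of all (t, x_t), and two
    such sets meet in d minus the Hamming distance of the vertices.  An induced
    path of the cube between antipodal vertices is thus a spindle of the same
    length.  If the d-cube has such a path P of length l, let Q be a path with
    4 edges from 0000 to 1111 in the 4-cube.  The serpentine that runs along P
    above the vertices 0, 2 and 4 of Q, forwards, backwards and forwards again,
    is an induced path of length 3 l + 4 between antipodal vertices of the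
    (d + 4)-cube.  This gives exponential length 2 * 3^k - 2 for d = 4 k. *)

Require Import Defs.
From mathcomp Require Import all_boot all_order all_algebra.
From mathcomp Require Import boolp zify.
Import Order.TTheory GRing.Theory Num.Theory.

Set Implicit Arguments.
Unset Strict Implicit.
Unset Printing Implicit Defensive.

(** * From an induced path of [d]-sets to a spindle *)

Section InducedPathSpindle.

Variables (S : finType) (d l : nat) (F : nat -> {set S}).
Hypothesis card_S : #|S| = 2 * d.
Hypothesis card_F : forall i, #|F i| = d.
(** Between [d]-sets, [d - #|F i :&: F j|] is half the size of the symmetric difference; only its
    being 0, 1 or larger matters. *)
Hypothesis F_induced : forall i j, i <= l -> j <= l ->
  minn 2 (d - #|F i :&: F j|) = minn 2 ((i - j) + (j - i)).
Hypothesis F_ends : forall s, (s \in F 0) (+) (s \in F l).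

Let A := [set F i | i : 'I_l.+1].
Let V := [set [set B] | B in A].
Let adj : rel {set {set S}} := fun X Y =>
  [exists i : 'I_l.+1, exists j : 'I_l.+1,
    [&& X == [set F i], Y == [set F j] & (i.+1 == j) || (j.+1 == i)]].

Lemma path_set_inj i j : i <= l -> j <= l -> F i = F j -> i = j.
Proof.
move=> il jl eqF; move: (F_induced il jl).
by rewrite eqF setIid card_F; lia.
Qed.

Lemma path_setP B : reflect (exists2 i, i <= l & B = F i) (B \in A).
Proof.
apply: (iffP imsetP) => [[i _ ->]|[i il ->]]; first by exists i => //; rewrite -ltnS.
by exists (Ordinal (il : i < l.+1)).
Qed.

Lemma path_vertexP X : reflect (exists2 i, i <= l & X = [set F i]) (X \in V).
Proof.
apply: (iffP imsetP) => [[B /path_setP[i il ->] ->]|[i il ->]]; first by exists i.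
by exists (F i) => //; apply/path_setP; exists i.
Qed.

Lemma path_adjP X Y :
  reflect (exists i j, [/\ i <= l, j <= l, X = [set F i], Y = [set F j]
                         & i.+1 = j \/ j.+1 = i]) (adj X Y).
Proof.
apply: (iffP existsP) => [[i /existsP[j /and3P[/eqP-> /eqP-> ij]]]|].
  exists i, j; split=> //; try by rewrite -ltnS.
  by case/orP: ij => /eqP; [left|right].
case=> i [j [il jl -> -> ij]].
exists (Ordinal (il : i < l.+1)); apply/existsP; exists (Ordinal (jl : j < l.+1)).
by rewrite !eqxx /=; case: ij => ->; rewrite eqxx ?orbT.
Qed.

Lemma path_adjE i j : i <= l -> j <= l ->
  adj [set F i] [set F j] = (i.+1 == j) || (j.+1 == i).
Proof.
move=> il jl; apply/path_adjP/orP.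
  case=> i' [j' [il' jl' /set1_inj eqi /set1_inj eqj]].
  rewrite (path_set_inj il il' eqi) (path_set_inj jl jl' eqj).
  by case=> ->; [left|right].
by case=> /eqP ij; exists i, j; split=> //; [left|right].
Qed.

Lemma path_sets_uniform : {in A, forall B : {set S}, #|B| = d}.
Proof. by move=> B /path_setP[i _ ->]. Qed.

Lemma path_vertices_partition : partition V A.
Proof.
apply/and3P; split.
- rewrite /cover; apply/eqP/setP=> B; apply/bigcupP/idP.
    by case=> X /imsetP[C CA ->] /set1P->.
  by move=> BA; exists [set B]; rewrite ?set11 //; apply: imset_f.
- apply/trivIsetP=> _ _ /imsetP[B _ ->] /imsetP[C _ ->] neq.
  by rewrite disjoints1 inE; apply: contraNN neq => /eqP->.
- by apply/negP=> /imsetP[B _ /setP/(_ B)]; rewrite !inE eqxx.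
Qed.

Lemma path_vertices_nonempty : V != set0.
Proof. by apply/set0Pn; exists [set F 0]; apply/path_vertexP; exists 0. Qed.

Lemma path_adj_support X Y : adj X Y -> X \in V /\ Y \in V.
Proof.
by case/path_adjP=> i [j [il jl -> -> _]]; split; apply/path_vertexP; [exists i|exists j].
Qed.

Lemma path_adj_sym : symmetric adj.
Proof.
suff sub X Y : adj X Y -> adj Y X by move=> X Y; apply/idP/idP; apply: sub.
case/path_adjP=> i [j [il jl -> -> ij]]; rewrite path_adjE //.
by case: ij => ->; rewrite eqxx ?orbT.
Qed.

Lemma path_adj_irrefl : irreflexive adj.
Proof.
move=> X; apply/path_adjP=> -[i [j [il jl -> /set1_inj eqF ij]]].
by have := path_set_inj il jl eqF; lia.
Qed.

Lemma path_adj_path i k : i + k <= l ->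
  path adj [set F i] [seq [set F j] | j <- iota i.+1 k]
  /\ last [set F i] [seq [set F j] | j <- iota i.+1 k] = [set F (i + k)].
Proof.
elim: k i => [|k IHk] i ikl; first by rewrite addn0.
have [|p_path p_last] := IHk i.+1; first by lia.
by rewrite /= path_adjE ?eqxx ?p_path ?p_last ?addSnnS //; lia.
Qed.

Lemma path_adj_connected : {in V &, forall X Y, connect adj X Y}.
Proof.
have from0 i : i <= l -> connect adj [set F 0] [set F i].
  move=> il; have [p_path p_last] := @path_adj_path 0 i il.
  by apply/connectP; exists [seq [set F j] | j <- iota 1 i].
move=> _ _ /path_vertexP[i il ->] /path_vertexP[j jl ->].
apply: connect_trans (from0 j jl).
by rewrite (sym_connect_sym path_adj_sym) from0.
Qed.

Let G := SubsetPartitionGraph path_sets_uniform path_vertices_partition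
  path_vertices_nonempty path_adj_support path_adj_sym path_adj_irrefl
  path_adj_connected.

Lemma path_vertex_of i : i <= l -> vertex_of G (F i) = [set F i].
Proof.
move=> il; have [_ tiV _] := and3P path_vertices_partition.
by apply: (def_pblock tiV); rewrite ?set11 //; apply/path_vertexP; exists i.
Qed.

Lemma path_strong_adjacency : strong_adjacency G.
Proof.
split=> [_ _ /path_setP[i il ->] /path_setP[j jl ->] meet|X Y].
  rewrite !path_vertex_of //= path_adjE //; have := F_induced il jl.
  have [->|neq] := eqVneq i j; first by left.
  by right; apply/orP; lia.
case/path_adjP=> i [j [il jl -> -> ij]]; exists (F i), (F j).
by split; rewrite ?set11 //; have := F_induced il jl; lia.
Qed.

(** Distinct sets of the path with a common subset of size [d - 1] have consecutive indices, and
    three indices cannot be pairwise consecutive. *)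
Lemma path_endpoint_count : endpoint_count d A.
Proof.
move=> E cardE; rewrite leqNgt; apply/negP=> /card_gt2P[B [C [D [[]]]]].
rewrite !inE => /andP[/path_setP[i il ->] Ei] /andP[/path_setP[j jl ->] Ej].
move=> /andP[/path_setP[k kl ->] Ek] [].
have close i' j' : i' <= l -> j' <= l -> E \subset F i' -> E \subset F j' ->
    F i' != F j' -> (i' - j') + (j' - i') = 1.
  move=> il' jl' Ei' Ej' neqF; have neq : i' != j' by apply: contraNneq neqF => ->.
  have /subset_leq_card : E \subset F i' :&: F j' by rewrite subsetI Ei'.
  by have := F_induced il' jl'; lia.
move=> /(close _ _ il jl Ei Ej) ? /(close _ _ jl kl Ej Ek) ? /(close _ _ kl il Ek Ei) ?.
lia.
Qed.

Lemma path_one_subset : one_subset G.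
Proof. by move=> _ /path_vertexP[i _ ->]; rewrite cards1. Qed.

Lemma path_apices : apices A (F 0) (F l).
Proof. by split=> //; apply/path_setP; [exists 0|exists l]. Qed.

(** Every edge changes the index by exactly one, so a walk from index [i] to index [l] has at least
    [l - i] edges. *)
Lemma path_distance :
  graph_distance (adjacent G) (vertex_of G (F 0)) (vertex_of G (F l)) l.
Proof.
rewrite !path_vertex_of //; split.
  have [p_path p_last] := @path_adj_path 0 l (leqnn l).
  by exists [seq [set F j] | j <- iota 1 l]; rewrite size_map size_iota.
suff far p i : i <= l -> path adj [set F i] p -> last [set F i] p = [set F l] ->
    l <= i + size p by move=> p; exact: (far p 0).
elim: p i => [|X p IHp] i il /=.
  by move=> _ /set1_inj/(path_set_inj il (leqnn l)); lia.
case/andP=> /path_adjP[i' [j [il' jl /set1_inj eqF -> ij]]] p_path p_last.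
by have := IHp j jl p_path p_last; have := path_set_inj il il' eqF; lia.
Qed.

Lemma induced_path_spindle : spindle_length d l.
Proof.
exists S, A, G, (F 0), (F l); split=> //.
- exact: path_strong_adjacency.
- exact: path_endpoint_count.
- exact: path_one_subset.
- by split; [exact: path_apices|exact: path_distance].
Qed.

End InducedPathSpindle.

(** * Induced paths in the cube *)

(** Truncating both distances at 2 says exactly that consecutive vertices are
    adjacent and that all others are distinct and non-adjacent. *)
Definition antipodal_induced_path (T : finType) l (f : nat -> T -> bool) :=
  (forall i j, i <= l -> j <= l ->
     minn 2 (\sum_t (f i t (+) f j t)) = minn 2 ((i - j) + (j - i)))
  /\ forall t, f 0 t (+) f l t.

Lemma cube_path_spindle (T : finType) l (f : nat -> T -> bool) :
  antipodal_induced_path l f -> spindle_length #|T| l.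
Proof.
case=> f_induced f_ends.
pose F i := [set (t, f i t) | t in T].
have FE i p : (p \in F i) = (p.2 == f i p.1).
  apply/imsetP/eqP=> [[t _ ->] //|]; case: p => t b /= ->.
  by exists t.
have card_F i : #|F i| = #|T| by rewrite card_imset // => t u [].
have meetF i j : #|F i :&: F j| = #|T| - \sum_t (f i t (+) f j t).
  have -> : F i :&: F j = [set (t, f i t) | t in [pred t | f i t == f j t]].
    apply/setP=> -[t b]; rewrite inE !FE /=; apply/andP/imsetP=> /=.
      by case=> /eqP-> /eqP eqf; exists t; rewrite ?inE ?eqf.
    by case=> u; rewrite inE => /eqP eqf [-> ->]; rewrite eqf.
  have -> : \sum_t (f i t (+) f j t) = #|[predC [pred t | f i t == f j t]]|.
    rewrite -sum1_card [RHS]big_mkcond; apply: eq_bigr => t _.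
    by rewrite !inE; case: (f i t); case: (f j t).
  by rewrite card_imset => [|t u []//]; rewrite -(cardC [pred t | f i t == f j t]) addnK.
apply: (@induced_path_spindle (T * bool)%type _ _ F) => // [|i j il jl|[t b]].
- by rewrite card_prod card_bool mulnC.
(* The Hamming distance is at most [#|T|], so the double truncated subtraction gives it back. *)
- rewrite meetF subKn ?f_induced // -sum1_card.
  by apply: leq_sum => t _; apply: leq_b1.
- by rewrite !FE /=; have := f_ends t; case: b; case: (f 0 t); case: (f l t).
Qed.

(** Prefix indicators are the vertices of a monotone path in the [n]-cube; for [n = 4] this is the
    path Q. *)
Lemma sum_prefix_addb n a b :
  \sum_(k < n) ((k < a) (+) (k < b)) =
  (minn n a - minn n b) + (minn n b - minn n a).
Proof.
elim: n => [|n IHn]; first by rewrite big_ord0 !min0n.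
by rewrite big_ord_recr /= IHn; case: (ltnP n a); case: (ltnP n b) => /=; lia.
Qed.

Lemma prefix_path n : antipodal_induced_path n (fun i (k : 'I_n) => k < i).
Proof.
split=> [i j il jl|k]; last by rewrite ltn_ord.
by rewrite sum_prefix_addb (minn_idPr il) (minn_idPr jl).
Qed.

(** * The serpentine and its iteration *)

(** The position on P in the serpentine, and then the position on Q. *)
Definition serpentine_pos l i : nat :=
  if i <= l then i else if i == l.+1 then l else if i <= 2 * l + 2 then
  2 * l + 2 - i else if i == 2 * l + 3 then 0 else i - (2 * l + 4).

Definition serpentine_level l i : nat :=
  if i <= l then 0 else if i == l.+1 then 1 else if i <= 2 * l + 2 then 2
  else if i == 2 * l + 3 then 3 else 4.

(** Hamming distances along P and Q add up. Distinct runs differ by at least 2 levels, and the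
    connecting vertices at levels 1 and 3 lie above an end of P, next only to the ends of the runs
    they join. *)
Lemma serpentine_path (T : finType) l (f : nat -> T -> bool) :
  antipodal_induced_path l f ->
  antipodal_induced_path (3 * l + 4) (fun i (t : T + 'I_4) =>
    match t with
    | inl u => f (serpentine_pos l i) u
    | inr k => k < serpentine_level l i
    end).
Proof.
case=> f_induced f_ends; split=> [i j il jl|t].
  have pos_le i' : i' <= 3 * l + 4 -> serpentine_pos l i' <= l.
    by rewrite /serpentine_pos; do 4?case: ifP; lia.
  have level_le i' : serpentine_level l i' <= 4.
    by rewrite /serpentine_level; do 4?case: ifP.
  rewrite big_sumType /= sum_prefix_addb !(minn_idPr (level_le _)).
  have := f_induced _ _ (pos_le i il) (pos_le j jl).
  (* Only [minn 2 h] is known, and it determines [minn 2 (h + q)] for every level distance [q]. *)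
  move: (\sum_t _) => h.
  rewrite /serpentine_pos /serpentine_level.
  by do 8?case: ifP; lia.
have [pos0 posl] : serpentine_pos l 0 = 0 /\ serpentine_pos l (3 * l + 4) = l.
  by rewrite /serpentine_pos; split=> //; do 4?case: ifP; lia.
have [level0 levell] : serpentine_level l 0 = 0 /\ serpentine_level l (3 * l + 4) = 4.
  by rewrite /serpentine_level; split=> //; do 4?case: ifP; lia.
by case: t => [u|k]; rewrite ?pos0 ?posl ?level0 ?levell ?ltn_ord.
Qed.

(** The recursion [l -> 3 * l + 4] triples [l + 2], starting from the one-vertex path in the
    0-cube. *)
Lemma exponential_spindle k : spindle_length (4 * k) (2 * 3 ^ k - 2).
Proof.
suff [T [f [<- f_path]]] : exists (T : finType) (f : nat -> T -> bool),
    #|T| = 4 * k /\ antipodal_induced_path (2 * 3 ^ k - 2) f.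
  exact: cube_path_spindle f_path.
elim: k => [|k [T [f [cardT f_path]]]].
  exists 'I_0, (fun i (k : 'I_0) => k < i).
  by split; [rewrite card_ord|apply: prefix_path].
have -> : 2 * 3 ^ k.+1 - 2 = 3 * (2 * 3 ^ k - 2) + 4.
  by have : 0 < 3 ^ k; rewrite ?expn_gt0 // expnS; lia.
eexists _, _; split; last exact: serpentine_path f_path.
by rewrite card_sum card_ord cardT; lia.
Qed.

(** * Existence of the maximum length *)

Lemma spindle_length_bounded d l : spindle_length d l -> l <= 2 ^ 2 ^ (2 * d).
Proof.
case=> S [A [G [A1 [A2 [<- _ _ _ [_ [[p [p_path p_last _]] l_min]]]]]]].
(* A path without repetition is no longer than the number of families of subsets of [S]. *)
case: (shortenP p_path) p_last => q q_path /= /andP[_ q_uniq] _ q_last.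
apply: leq_trans (l_min q q_path q_last) _; have /card_uniqP <- := q_uniq.
by apply: leq_trans (max_card _) _; rewrite -cardsT -powersetT card_powerset cardsT
  -cardsT -powersetT card_powerset cardsT.
Qed.

Lemma max_spindle_length_exists d : exists l, max_spindle_length d l.
Proof.
have ex_length : exists l, `[< spindle_length d l >].
  exists d; apply/asboolP; rewrite -[X in spindle_length X _]card_ord.
  exact: cube_path_spindle (prefix_path d).
have length_le l : `[< spindle_length d l >] -> l <= 2 ^ 2 ^ (2 * d).
  by move=> /asboolP/spindle_length_bounded.
have [l /asboolP l_length l_max] := ex_maxnP ex_length length_le.
by exists l; split=> // l' /asboolP/l_max.
Qed.

(** The shift by 4 is needed, as 37 > 27 at exponent 3; the [+ 1] absorbs the [- 2] in the spindle
    length. *)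
Lemma quadratic_lt_pow3 k : 4 * (k + 4) ^ 2 + 1 <= 3 ^ (k + 4).
Proof.
elim: k => [//|k]; rewrite -!mulnn addSn expnS.
by move: (3 ^ _) => u; nia.
Qed.

Local Open Scope ring_scope.

Theorem theorem4p5 :
  exists L : nat -> nat,
    (forall d : nat, (0 < d)%N -> max_spindle_length d (L (2 * d)%N)) /\
    (forall N : nat, exists n d : nat,
      [/\ (N < n)%N, n = (2 * d)%N &
          (1 / 8 : rat) <= (L n)%:R / n%:R ^+ 2]).
Proof.
have [M M_max] := choice max_spindle_length_exists.
(* At odd [n] the value is irrelevant. *)
exists (fun n => M n./2); split=> [d _|N]; first by rewrite mul2n doubleK.
pose k := (N + 4)%N; exists (2 * (4 * k))%N, (4 * k)%N; split=> //.
  by rewrite /k; lia.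
rewrite mul2n doubleK -mul2n.
(* Since [n = 8 * k], the bound [8 * k ^ 2] is exactly one eighth of the square of [n]. *)
have M_ge : (8 * k ^ 2 <= M (4 * k))%N.
  have := (M_max (4 * k)%N).2 _ (exponential_spindle k).
  by have := quadratic_lt_pow3 N; rewrite -/k; lia.
have n_gt0 : (0 : rat) < (2 * (4 * k))%:R ^+ 2.
  by rewrite exprn_gt0 // ltr0n /k; lia.
rewrite ler_pdivlMr // mulrC mulrA ler_pdivrMr ?ltr0n // mulr1.
by rewrite -natrX -natrM ler_nat; nia.
Qed.
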